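(* Let $q\geq 2$ be an integer, let $(X,\mathcal{B}_X,\mu,T)$ be a $\mathbb{Z}^q$-MPS and let $\vec{v}=(1,\beta_2,\ldots,\beta_q)\in\mathbb{R}^q$ be a direction vector. Then the following two conditions are equivalent. (a) $\mu$ has $\vec{v}$-discrete spectrum. (b) $(X,\mathcal{B}_X,\mu,T)$ is $\vec{v}$-null.
   Context: A $\mathbb{Z}^q$-measure preserving dynamical system ($\mathbb{Z}^q$-MPS) is a quadruple $(X,\mathcal{B}_X,\mu,T)$ where $X$ is a compact metric space, $\mathcal{B}_X$ its Borel $\sigma$-algebra, $T$ assigns to each $\vec{w}\in\mathbb{Z}^q$ a homeomorphism $T^{\vec{w}}:X\to X$ with $T^{\vec{w}}\circ T^{\vec{u}}=T^{\vec{w}+\vec{u}}$ and $T^{\vec{0}}=\mathrm{id}_X$, and $\mu$ is a Borel probability measure on $X$ invariant under every $T^{\vec{w}}$. For $\vec{v}=(1,\beta_2,\ldots,\beta_q)\in\mathbb{R}^q$ and $\mathbf{b}=(b_2,\ldots,b_q)\in\mathbb{R}^{q-1}_+$ (all $b_i>0$), put $$\Lambda^{\vec{v}}(\mathbf{b})=\{(m_1,\ldots,m_q)\in\mathbb{Z}^q:\beta_i m_1-b_i/2\leq m_i\leq\beta_i m_1+b_i/2,\ i=2,\ldots,q\}.$$ For a finite measurable partition $\alpha$, $H_\mu(\alpha)=-\sum_{A\in\alpha}\mu(A)\log\mu(A)$ (with $0\log 0=0$). An infinite subset $S=\{\vec{w}_i\}_{i=1}^\infty$ of $\mathbb{Z}^q$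 is understood to come with an enumeration as a sequence of pairwise distinct elements; put $$h^S_\mu(T,\alpha)=\limsup_{k\to\infty}\frac1k H_\mu\left(\bigvee_{i=1}^k T^{-\vec{w}_i}\alpha\right),\qquad h^S_\mu(T)=\sup_\alpha h^S_\mu(T,\alpha),$$ the supremum being over all finite measurable partitions of $X$. Let $U_T^{\vec{w}}f=f\circ T^{\vec{w}}$ for $f\in L^2(X,\mathcal{B}_X,\mu)$. The $\vec{v}$-directional Kronecker algebra is $$\mathcal{K}_\mu^{\vec{v}}=\left\{B\in\mathcal{B}_X:\overline{\{U_T^{\vec{w}}1_B:\vec{w}\in\Lambda^{\vec{v}}(\mathbf{b})\}}\text{ is compact in }L^2(X,\mathcal{B}_X,\mu)\right\};$$ it is a $\sigma$-algebra and does not depend on the choice of $\mathbf{b}\in\mathbb{R}^{q-1}_+$. $\mu$ has $\vec{v}$-discrete spectrum if $\mathcal{K}_\mu^{\vec{v}}=\mathcal{B}_X$. The system is $\vec{v}$-null if for any $\mathbf{b}\in\mathbb{R}^{q-1}_+$ and any infinite subset $S$ of $\Lambda^{\vec{v}}(\mathbf{b})$, $h^S_\mu(T)=0$. *)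

(* Defs.v *)
From HB Require Import structures.
From mathcomp Require Import all_boot all_order all_algebra.
From mathcomp Require Import all_classical all_reals all_analysis.
From mathcomp Require Import measurable_realfun.
Set Implicit Arguments.
Unset Strict Implicit.
Unset Printing Implicit Defensive.
Import Order.TTheory GRing.Theory Num.Theory.
Import numFieldNormedType.Exports.
Local Open Scope classical_set_scope.
Local Open Scope ring_scope.

Section Lp_metric.
Context d (T : measurableType d) (R : realType).
Variables (mu : {measure set T -> \bar R}) (p : \bar R) (p1 : (1 <= p)%E).
Implicit Types f g h : LspaceType mu p1.

HB.instance Definition _ := gen_eqMixin (LspaceType mu p1).
HB.instance Definition _ := gen_choiceMixin (LspaceType mu p1).

(* Elements of LspaceType mu p1 are classes modulo almost-everywhere equality;
   as functions they are evaluated through a chosen representative. *)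
Definition Lp_dist f g : R :=
  fine ('N[mu]_p[EFin \o ((f : T -> R) \- (g : T -> R))%R])%E.

Lemma Lspace_Lfun f : (f : T -> R) \in Lfun mu p.
Proof.
apply/andP; split; rewrite inE.
- exact: (@measurable_funPT _ _ _ _ (repr (LebesgueSpace.sort f))).
- by case: f => s [[]].
Qed.

Lemma Lspace_eq f g : (f : T -> R) = g %[ae mu] -> f = g.
Proof.
case: f g => [s [[fs]]] [t [[ft]]] /= st.
have e : s = t.
  by rewrite -[s]reprK -[t]reprK; apply/eqmodP/asboolP.
by move: ft; rewrite -e => ft; rewrite (Prop_irrelevance fs ft).
Qed.

Let Lsub f g : ((f : T -> R) \- (g : T -> R)) \in Lfun mu p.
Proof.
have [_ H] := Lfun_submod_closed mu p1.
have := H (-1) g f (Lspace_Lfun g) (Lspace_Lfun f).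
suff -> : (-1) *: (g : T -> R) + (f : T -> R) = (f : T -> R) \- (g : T -> R).
  by [].
by apply/funext => x /=; rewrite fctE/= addrC scaleN1r.
Qed.

Let distE f g :
  (Lp_dist f g)%:E = ('N[mu]_p[EFin \o ((f : T -> R) \- (g : T -> R))%R])%E.
Proof.
exact: (@finite_norm_fine _ _ _ mu p p1 (Lfun_Sub p1 (Lsub f g))).
Qed.

Let dist_xx f : Lp_dist f f = 0.
Proof.
apply/EFin_inj; rewrite distE (_ : _ \o _ = cst 0%E).
  by rewrite Lnorm0// gt_eqF// (lt_le_trans _ p1).
by apply/funext => x /=; rewrite subrr.
Qed.

Let dist_positivity f g : Lp_dist f g = 0 -> f = g.
Proof.
move=> /(@fine_Lnormr_eq0 _ _ _ mu p p1 (Lfun_Sub p1 (Lsub f g))) fg.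
apply: Lspace_eq; apply: filterS fg => x /(_ I)/= /eqP.
by rewrite subr_eq0 => /eqP.
Qed.

Let dist_sym f g : Lp_dist f g = Lp_dist g f.
Proof.
rewrite /Lp_dist -oppe_Lnorm; congr (fine (Lnorm _ _ _)).
by apply/funext => x /=; rewrite opprB.
Qed.

Let dist_triangle g f h : Lp_dist f h <= Lp_dist f g + Lp_dist g h.
Proof.
rewrite -lee_fin EFinD !distE.
rewrite (_ : EFin \o ((f : T -> R) \- (h : T -> R)) =
  EFin \o (((f : T -> R) \- (g : T -> R)) \+ ((g : T -> R) \- (h : T -> R)))).
  apply: eminkowski => //.
  - by have /andP[+ _] := Lsub f g; rewrite inE.
  - by have /andP[+ _] := Lsub g h; rewrite inE.
by apply/funext => x /=; rewrite addrA subrK.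
Qed.

HB.instance Definition _ := @isMetric.Build R (LspaceType mu p1)
  Lp_dist dist_xx dist_positivity dist_sym dist_triangle.

End Lp_metric.

Section L2.
Context d (T : measurableType d) (R : realType).
Variable mu : {measure set T -> \bar R}.

Let measurable_sqr (f : T -> R) : measurable_fun setT f ->
  measurable_fun setT ((fun x => `|(f x)%:E| `^ 2)%E : T -> \bar R).
Proof.
move=> mf; apply: (measurableT_comp (measurable_poweR _)) => //.
exact/measurableT_comp/measurable_EFinP.
Qed.

Section class.
Variables (f : T -> R) (Lf : f \in Lfun mu 2%:R%:E).

Let mf : @measurable_fun _ _ T (measurableTypeR R) setT f.
Proof. exact: set_mem (sub_Lfun_mfun Lf). Qed.

Let f_mfun : {mfun T >-> measurableTypeR R} :=
  HB.pack f (isMeasurableFun.Build _ _ T (measurableTypeR R) f mf).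

Let f_quot : {mfun_ mu, T >-> measurableTypeR R} := \pi%qT f_mfun.

Let f_quotE : (f_quot : T -> R) = f %[ae mu].
Proof. by have /eqmodP/asboolP := reprK f_quot. Qed.

Let f_quot_finite : finite_norm mu 2%:R%:E f_quot.
Proof.
have := set_mem (sub_Lfun_finLfun Lf).
rewrite /= /finite_norm; congr (_ < _)%E; rewrite unlock; congr poweR.
apply: ge0_ae_eq_integral => //.
- by apply: measurable_sqr; exact: mf.
- apply: measurable_sqr.
  exact: (@measurable_funPT _ _ _ _ (repr f_quot)).
- by move=> x _; exact: poweR_ge0.
- by move=> x _; exact: poweR_ge0.
- by apply: filterS f_quotE => x /= + _ => /(_ I) ->.
Qed.

Definition L2_class : LspaceType2 mu :=
  HB.pack f_quot (isFinLebesgue.Build _ _ _ mu _ (lee1n 2) f_quot f_quot_finite).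

Lemma L2_classE : (L2_class : T -> R) = f %[ae mu].
Proof. exact: f_quotE. Qed.
End class.

Lemma eq_L2_class (f g : T -> R) (Lf : f \in Lfun mu 2%:R%:E)
    (Lg : g \in Lfun mu 2%:R%:E) :
  f = g %[ae mu] -> L2_class Lf = L2_class Lg.
Proof.
move=> fg; apply: Lspace_eq.
apply: ae_eq_trans (L2_classE Lf) _.
exact/(ae_eq_trans fg)/ae_eq_sym/L2_classE.
Qed.

Section compose.
Variables (phi : T -> T) (mphi : measurable_fun setT phi).
Hypothesis mu_phi : forall A, measurable A -> mu (phi @^-1` A) = mu A.

Lemma Lfun_comp (f : T -> R) :
  f \in Lfun mu 2%:R%:E -> f \o phi \in Lfun mu 2%:R%:E.
Proof.
move=> Lf; have mf : measurable_fun setT f by exact: set_mem (sub_Lfun_mfun Lf).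
apply/andP; split; rewrite inE; first exact: measurableT_comp.
have := set_mem (sub_Lfun_finLfun Lf).
rewrite /= /finite_norm; congr (_ < _)%E; rewrite unlock; congr poweR.
rewrite -(@eq_measure_integral _ _ _ _ mu (pushforward mu phi))//; last first.
  by move=> A mA _; exact: mu_phi.
rewrite ge0_integral_pushforward//; first exact: (measurable_sqr mf).
by move=> y _; exact: poweR_ge0.
Qed.

Definition L2_comp (f : LspaceType2 mu) : LspaceType2 mu :=
  L2_class (Lfun_comp (Lspace_Lfun f)).

Lemma L2_compE (f : LspaceType2 mu) :
  (L2_comp f : T -> R) = (f : T -> R) \o phi %[ae mu].
Proof. exact: L2_classE. Qed.

End compose.

Lemma Lfun_indic (B : set T) : (mu setT < +oo)%E -> measurable B ->
  (\1_B : T -> R) \in Lfun mu 2%:R%:E.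
Proof.
move=> fmu mB; apply/andP; split; rewrite inE; first exact: measurable_indic.
rewrite /= /finite_norm unlock poweR_lty//.
rewrite (eq_integral (EFin \o \1_B)) ?integral_indic ?setIT//.
  by rewrite (le_lt_trans _ fmu)// le_measure ?inE.
move=> x _ /=; rewrite indicE; case: (x \in B) => /=.
  by rewrite normr1 powR1.
by rewrite normr0 powR0.
Qed.
End L2.

(* A measurableType is a pointed type in the library; a space that carries a
   probability measure is nonempty, so asking for a point loses nothing. *)
#[short(type="pmetricType")]
HB.structure Definition PointedMetric (K : numDomainType) :=
  {M of Metric K M & isPointed M}.

Definition borel (X : ptopologicalType) := g_sigma_algebraType (@open X).
HB.instance Definition _ (X : ptopologicalType) := Measurable.on (borel X).

Definition homeomorphism (X Y : topologicalType) (f : X -> Y) :=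
  exists g : Y -> X,
    [/\ continuous f, continuous g, cancel f g & cancel g f].

Record Zq_MPS (R : realType) (q : nat) (X : pmetricType R) := ZqMPS {
  mps_compact : compact [set: X] ;
  mps_act :> 'rV[int]_q -> X -> X ;
  mps_homeo : forall w, homeomorphism (mps_act w) ;
  mps_actD : forall w u, mps_act w \o mps_act u = mps_act (w + u) ;
  mps_act0 : mps_act 0 = id ;
  mps_mu : probability (borel X) R ;
  mps_inv : forall w (A : set (borel X)), measurable A ->
    mps_mu (mps_act w @^-1` A) = mps_mu A
}.

(* With q = r.+1, coordinate 1 of a vector of length q is ord0, and coordinates
   2, ..., q are the lift ord0 i for i : 'I_r; b = (b_2, ..., b_q) is indexed by
   'I_r.  The slopes beta_2, ..., beta_q are the last r coordinates of v. *)
Definition Lambda (R : realType) (r : nat) (v : 'rV[R]_r.+1) (b : 'rV[R]_r) :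
    set 'rV[int]_r.+1 :=
  [set m | forall i : 'I_r,
    v 0 (lift ord0 i) * (m 0 ord0)%:~R - b 0 i / 2 <= (m 0 (lift ord0 i))%:~R
    <= v 0 (lift ord0 i) * (m 0 ord0)%:~R + b 0 i / 2].

Definition positive_vector (R : realType) (r : nat) (b : 'rV[R]_r) :=
  forall i, 0 < b 0 i.

Section partitions.
Variable X : Type.
Implicit Types P Q : set (set X).

Definition join_partition P Q : set (set X) :=
  [set A `&` B | A in P & B in Q] `\ set0.

Definition preimage_partition (f : X -> X) P : set (set X) :=
  [set f @^-1` A | A in P].

End partitions.

Section entropy.
Context d (T : measurableType d) (R : realType).

Definition finite_measurable_partition (alpha : set (set T)) :=
  [/\ finite_set alpha, alpha `<=` measurable &
      partition alpha id [set: T]].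

Variable mu : probability T R.

Definition entropy (alpha : set (set T)) : R :=
  - \sum_(A \in alpha) (fine (mu A) * ln (fine (mu A))).

End entropy.

Section system.
Context (R : realType) (q : nat) (X : pmetricType R) (S : Zq_MPS q X).
Notation mu := (mps_mu S).

(* The sequence w_1, w_2, ... is numbered from 0, so this is the join of the
   T^{-w_i} alpha for i = 1, ..., k; the empty join is the trivial partition. *)
Definition partition_along (w : nat -> 'rV[int]_q) (alpha : set (set (borel X)))
    (k : nat) : set (set (borel X)) :=
  \big[@join_partition (borel X)/[set [set: borel X]]]_(i < k)
    preimage_partition (S (w i)) alpha.

(* The value at k = 0 is 0 and does not affect the limsup. *)
Definition seq_entropy_part (w : nat -> 'rV[int]_q)
    (alpha : set (set (borel X))) : \bar R :=
  limn_esup (fun k => (k%:R^-1 * entropy mu (partition_along w alpha k))%:E).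

Definition seq_entropy (w : nat -> 'rV[int]_q) : \bar R :=
  ereal_sup [set seq_entropy_part w alpha |
             alpha in @finite_measurable_partition _ (borel X)].

Lemma mps_measurable (w : 'rV[int]_q) :
  measurable_fun [set: borel X] (S w : borel X -> borel X).
Proof.
have [_ [/continuousP cS _ _ _]] := mps_homeo S w.
apply: (@measurability _ _ (borel X) (borel X) _ _ (@open X)) => //.
move=> _ [A oA <-]; rewrite setTI; apply: sub_sigma_algebra; exact: cS.
Qed.

(* L^2 is the real Hilbert space: the orbits of indicators live in it, and it is
   closed in the complex one. *)
Definition koopman (w : 'rV[int]_q) (f : LspaceType2 mu) : LspaceType2 mu :=
  L2_comp (mps_measurable w) (@mps_inv _ _ _ S w) f.

Lemma mps_fin : (mu [set: borel X] < +oo)%E.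
Proof. by rewrite probability_setT ltry. Qed.

Definition L2_indic (B : set (borel X)) (mB : measurable B) : LspaceType2 mu :=
  L2_class (Lfun_indic mps_fin mB).

End system.

Section directional.
Context (R : realType) (r : nat) (X : pmetricType R) (S : Zq_MPS r.+1 X).
Variable v : 'rV[R]_r.+1.

Definition kronecker_algebra (b : 'rV[R]_r) : set (set (borel X)) :=
  [set B | exists mB : measurable B,
    compact (closure [set koopman w (L2_indic S mB) | w in Lambda v b])].

(* The Kronecker algebra does not depend on the positive vector b, which is
   therefore left as a parameter. *)
Definition discrete_spectrum (b : 'rV[R]_r) :=
  kronecker_algebra b = measurable.

(* An infinite subset of Lambda v b comes with an enumeration by pairwise
   distinct elements, that is, an injective sequence with values in it. *)
Definition null_system :=
  forall b : 'rV[R]_r, positive_vector b ->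
  forall w : nat -> 'rV[int]_r.+1, injective w -> range w `<=` Lambda v b ->
  seq_entropy S w = 0%E.

End directional.

(* Main.v *)
Require Import Defs.
From mathcomp Require Import all_boot all_order all_algebra finmap.
From mathcomp Require Import all_classical all_reals all_analysis.
From mathcomp Require Import ring lra measurable_realfun.
Set Implicit Arguments.
Unset Strict Implicit.
Unset Printing Implicit Defensive.
Import Order.TTheory GRing.Theory Num.Theory.
Import numFieldNormedType.Exports.
Local Open Scope classical_set_scope.
Local Open Scope ring_scope.

(** Both conditions say something about the sets T^{-w}B, w in the strip
Lambda, inside the measure algebra with the pseudo-metric mu (A symmetric
difference B), which is the square of the L^2 distance of the indicators
([mdist_indic]).  That metric space is complete ([disag_complete]), so the orbit
of 1_B has compact closure exactly when it is totally bounded, that is, when for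
each e finitely many translates form an e-net ([compact_orbit_net],
[orbit_net_compact]).

If all orbits are totally bounded, then for a finite partition alpha and e > 0
there are finitely many u_1, ..., u_N such that each T^{-w} alpha agrees with some
T^{-u_j} alpha outside a set of measure e ([orbit_net_fin]).  The names of a point
along the T^{-u_j} alpha therefore predict each T^{-w_i} alpha with error
probability e, and a code that transmits these names once and then corrects the
errors shows that the entropy of the k-fold join is at most N log |alpha| + k eta,
with eta small ([entropy_coding], [orbit_net_entropy]).  Each strip is covered by
finitely many translates of a given one ([Lambda_cover]), which carries the nets
from the given b to all others.

Conversely, suppose that the orbit of B is not totally bounded: for some e no
finite set of translates is an e-net.  If each translate were within e / 2 of one
of the finitely many sets of a finite algebra P, one translate near each of these
sets would give an e-net; hence some T^{-w}B has distance at least e / 2 to all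
sets of P ([orbit_gap]), and joining it to P raises the entropy by at least
(e / 2) log 2 ([entropy_gain]).  Choosing w_1, w_2,
... in this greedy way gives a sequence of entropy at least (e / 2) log 2 > 0 for
the partition {B, complement of B} ([entropy_of_gap]). *)

(** * Finite labellings of a probability space *)

Section finite_valued_functions.
Context d (T : measurableType d) (R : realType) (mu : probability T R).

Definition prob (A : set T) : R := fine (mu A).

(** Measurability for the discrete sigma-algebra on [J].  Asking it of every
subset of [J] makes the notion stable under all maps out of [J]. *)
Definition discrete_measurable (J : Type) (f : T -> J) :=
  forall P : set J, measurable (f @^-1` P).

Lemma prob_ge0 A : 0 <= prob A.
Proof. exact: fine_ge0. Qed.

Lemma EFin_prob A : measurable A -> (prob A)%:E = mu A.
Proof. by move=> mA; rewrite /prob fineK// fin_num_measure. Qed.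

Lemma prob_le A B : measurable A -> measurable B -> A `<=` B -> prob A <= prob B.
Proof.
by move=> mA mB AB; rewrite -lee_fin !EFin_prob//; apply: le_measure; rewrite ?inE.
Qed.

Lemma prob_setT : prob setT = 1.
Proof. by rewrite /prob probability_setT. Qed.

Lemma prob_le1 A : measurable A -> prob A <= 1.
Proof. by move=> mA; rewrite -prob_setT prob_le. Qed.

Lemma prob_set0 : prob set0 = 0.
Proof. by rewrite /prob measure0. Qed.

Lemma prob_setU_le A B : measurable A -> measurable B ->
  prob (A `|` B) <= prob A + prob B.
Proof.
move=> mA mB; rewrite -lee_fin EFinD !EFin_prob//; last exact: measurableU.
exact: measureU2.
Qed.

Lemma prob_bigsetU_le (J : Type) (s : seq J) (F : J -> set T) :
  (forall j, measurable (F j)) ->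
  prob (\big[setU/set0]_(j <- s) F j) <= \sum_(j <- s) prob (F j).
Proof.
move=> mF; elim: s => [|j s IH]; first by rewrite !big_nil prob_set0.
rewrite !big_cons; apply: le_trans (lerD (lexx _) IH); apply: prob_setU_le => //.
exact: bigsetU_measurable.
Qed.

Lemma discrete_measurable_comp (J K : Type) (h : J -> K) (f : T -> J) :
  discrete_measurable f -> discrete_measurable (h \o f).
Proof. by move=> mf P; rewrite comp_preimage; exact: mf. Qed.

Lemma discrete_measurable_fin (J : finType) (f : T -> J) :
  (forall j, measurable (f @^-1` [set j])) -> discrete_measurable f.
Proof.
move=> mf P; rewrite (_ : f @^-1` P = \bigcup_(j in P) f @^-1` [set j]).
  by apply: fin_bigcup_measurable => // j _; exact: mf.
by apply/seteqP; split=> [x Px|x [j Pj /= ->]//]; exists (f x).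
Qed.

Lemma discrete_measurable_pair (J K : finType) (f : T -> J) (g : T -> K) :
  discrete_measurable f -> discrete_measurable g ->
  discrete_measurable (fun x => (f x, g x)).
Proof.
move=> mf mg; apply: discrete_measurable_fin => -[j k].
rewrite (_ : _ @^-1` _ = f @^-1` [set j] `&` g @^-1` [set k]).
  exact: measurableI.
by apply/seteqP; split=> x /= [-> ->].
Qed.

Lemma discrete_measurable_ffun (I J : finType) (f : I -> T -> J) :
  (forall i, discrete_measurable (f i)) ->
  discrete_measurable (fun x => [ffun i => f i x]).
Proof.
move=> mf; apply: discrete_measurable_fin => j.
rewrite (_ : _ @^-1` _ = \bigcap_(i in [set: I]) f i @^-1` [set j i]).
  by apply: fin_bigcap_measurable => // i _; exact: mf.
apply/seteqP; split=> x /= H; first by move=> i _ /=; rewrite -H ffunE.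
by apply/ffunP => i; rewrite ffunE; exact: H.
Qed.

Lemma prob_sum (J : finType) (f : T -> J) (P : pred J) :
  discrete_measurable f ->
  prob [set x | P (f x)] = \sum_(j | P j) prob (f @^-1` [set j]).
Proof.
move=> mf; rewrite /prob.
rewrite (_ : [set x | P (f x)] = \bigcup_(j in [set j | P j]) f @^-1` [set j]).
  rewrite measure_fin_bigcup//; last 2 first.
  - exact: finite_finset.
  - by move=> i j _ _ [x [/= <- <-]].
  rewrite (_ : [set j | P j] = [set` [seq j <- enum J | P j]]); last first.
    by apply/seteqP; split=> j; rewrite /= mem_filter mem_enum andbT.
  rewrite -fsbig_seq; last exact/filter_uniq/enum_uniq.
  rewrite big_filter big_enum_cond/=.
  by rewrite sum_fine// => j Pj; rewrite fin_num_measure.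
by apply/seteqP; split=> [x Px|x [j Pj /= ->//]]; exists (f x).
Qed.

Lemma sum_prob (J : finType) (f : T -> J) :
  discrete_measurable f -> \sum_j prob (f @^-1` [set j]) = 1.
Proof.
by move=> mf; rewrite -(prob_sum xpredT mf) -prob_setT; congr prob; exact/seteqP.
Qed.

Lemma sum_prob_comp (J K : finType) (f : T -> J) (h : J -> K) (phi : K -> R) :
  discrete_measurable f ->
  \sum_k prob ((h \o f) @^-1` [set k]) * phi k =
  \sum_j prob (f @^-1` [set j]) * phi (h j).
Proof.
move=> mf; rewrite [RHS](partition_big h xpredT)//=; apply: eq_bigr => k _.
rewrite (_ : (h \o f) @^-1` [set k] = [set x | h (f x) == k]); last first.
  by apply/seteqP; split=> x /= /eqP.
rewrite (prob_sum (fun j => h j == k) mf) mulr_suml.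
by apply: eq_bigr => j /eqP <-.
Qed.

(** Finite partitions are handled as labellings [f].  Only the fibres over the
range of [f] are kept, because [join_partition] also discards the empty set;
empty fibres contribute 0 ln 0 = 0 to the entropy. *)
Definition atoms (J : Type) (f : T -> J) : set (set T) :=
  range (fun x => f @^-1` [set f x]).

Lemma eq_atoms (J K : Type) (f : T -> J) (g : T -> K) :
  (forall x y, f x = f y <-> g x = g y) -> atoms f = atoms g.
Proof.
move=> fg; rewrite /atoms; congr (_ @` _); apply/funext => x.
by apply/seteqP; split=> y /= /fg.
Qed.

Lemma entropy_atoms (J : finType) (f : T -> J) :
  entropy mu (atoms f) =
  - \sum_j prob (f @^-1` [set j]) * ln (prob (f @^-1` [set j])).
Proof.
rewrite /entropy; congr (- _).
pose h j := f @^-1` [set j].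
rewrite (_ : atoms f = h @` range f); last first.
  by rewrite image_comp.
rewrite fsbig_image; last first.
  move=> _ _ /set_mem[x _ <-] /set_mem[y _ <-] hxy.
  by have : h (f y) x by rewrite -hxy.
have -> : \sum_j prob (h j) * ln (prob (h j)) =
    \sum_(j <- enum J) prob (h j) * ln (prob (h j)) by rewrite big_enum.
rewrite (fsbig_fwiden (enum J)) ?enum_uniq//.
  by move=> j; rewrite /= mem_enum.
move=> j /= [_ jf]; rewrite (_ : h j = set0); last first.
  by apply/seteqP; split=> // x /= fx; apply: jf; exists x.
by rewrite measure0 mul0r.
Qed.

Lemma plnp_le0 (p : R) : 0 <= p <= 1 -> p * ln p <= 0.
Proof. by move=> /andP[p0 p1]; rewrite mulr_ge0_le0// ln_le0. Qed.

Lemma entropy_atoms_ge0 (J : finType) (f : T -> J) :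
  discrete_measurable f -> 0 <= entropy mu (atoms f).
Proof.
move=> mf; rewrite entropy_atoms oppr_ge0 sumr_le0// => j _.
by rewrite plnp_le0// prob_ge0 prob_le1.
Qed.

End finite_valued_functions.

(** * Entropy of predictable and of unpredictable labellings *)

(** Termwise [p ln (q / p) <= q - p], from [ln x <= x - 1]. *)
Lemma gibbs (R : realType) (J : finType) (p q : J -> R) :
  (forall j, 0 <= p j) -> (forall j, 0 < q j) ->
  \sum_j q j <= \sum_j p j ->
  - \sum_j p j * ln (p j) <= - \sum_j p j * ln (q j).
Proof.
move=> p0 q0 qp; rewrite lerN2 -subr_ge0 -sumrB.
apply: (@le_trans _ _ (\sum_j (p j - q j))); first by rewrite sumrB subr_ge0.
apply: ler_sum => j _; have := p0 j; rewrite le_eqVlt => /predU1P[<-|pj].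
  by rewrite !mul0r subr0 sub0r oppr_le0 ltW.
rewrite -mulrBr -lerN2 opprB -mulrN opprB -ln_div ?posrE//.
have qpj : 0 < q j / p j by rewrite divr_gt0.
apply: (@le_trans _ _ (p j * (q j / p j - 1))).
  rewrite ler_wpM2l//.
  have := @le_ln1Dx R (q j / p j - 1).
  by rewrite addrCA subrr addr0; apply; rewrite ltrBrDr addrC subrr.
by rewrite mulrBr mulr1 mulrCA divff ?mulr1// gt_eqF.
Qed.

Section entropy_bounds.
Context d (T : measurableType d) (R : realType) (mu : probability T R).
Notation prob := (prob mu).

Section coding.
(** The side information [g] allows each [F i] to be guessed with an error of
probability at most [eps].  The distribution [q] below is that of the output of a
noisy channel: [b] is drawn uniformly from [G], then the guesses from [b] are
transmitted independently, each being replaced with probability [del] by a uniform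
letter of [I].  The cost [- ln q] of a word is small if the word differs in few
places from the guesses of some [b], and by [gibbs] the expected cost bounds the
entropy. *)
Variables (I G : finType) (k : nat) (F : 'I_k -> T -> I) (g : T -> G).
Variables (guess : 'I_k -> G -> I) (del eps : R).
Hypotheses (mF : forall i, discrete_measurable (F i)).
Hypotheses (mg : discrete_measurable g).
Hypotheses (del0 : 0 < del) (del1 : del < 1).
Hypothesis guessP : forall i, prob [set x | F i x != guess i (g x)] <= eps.

Let n : R := #|I|%:R.
Let noisy (a b : I) : R := (1 - del) * (a == b)%:R + del / n.

Let card_gt0 (K : finType) (a : K) : 0 < #|K|%:R :> R.
Proof. by rewrite ltr0n; apply/card_gt0P; exists a. Qed.

Let noisy_gt0 a b : 0 < noisy a b.
Proof.
rewrite ltr_wpDl ?divr_gt0 ?(card_gt0 a)//.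
by rewrite mulr_ge0 ?ler0n// subr_ge0 ltW.
Qed.

Let sum_noisy b : \sum_a noisy a b = 1.
Proof.
rewrite big_split/= -mulr_sumr sumr_const -(mulr_natr (del / n)).
rewrite -/n divfK ?gt_eqF ?(card_gt0 b)//.
rewrite (bigD1 b)//= eqxx big1 => [|a /negbTE->//].
by rewrite addr0 mulr1 subrK.
Qed.

Let cost (e : bool) : R := - ln (1 - del) + e%:R * ln (n / del).

Let noisy_cost a b : - ln (noisy a b) <= cost (a != b).
Proof.
have n0 := card_gt0 a.
have n1 : 1 <= n by rewrite ler1n; apply/card_gt0P; exists a.
have d1 : 0 < 1 - del by rewrite subr_gt0.
have nd : 0 < 1 - del + del / n by rewrite addr_gt0// divr_gt0.
rewrite /cost /noisy; case: eqP => _ /=.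
  rewrite mul0r addr0 mulr1 lerN2 ler_ln ?posrE//.
  by rewrite lerDl divr_ge0// ltW.
rewrite mulr0 add0r mul1r -lnV ?posrE ?divr_gt0// invf_div lerDr oppr_ge0.
by rewrite ln_le0// gerBl ltW.
Qed.

Let q (c : {ffun 'I_k -> I}) : R :=
  #|G|%:R^-1 * \sum_b \prod_i noisy (c i) (guess i b).

Let q_ge (c : {ffun _ -> I}) b :
  #|G|%:R^-1 * \prod_i noisy (c i) (guess i b) <= q c.
Proof.
rewrite /q ler_wpM2l ?invr_ge0 ?ler0n// (bigD1 b)//= lerDl.
by apply: sumr_ge0 => b' _; apply: prodr_ge0 => i _; exact: ltW.
Qed.

Let q_gt0 (b : G) c : 0 < q c.
Proof.
apply: lt_le_trans (q_ge c b); rewrite mulr_gt0 ?invr_gt0 ?card_gt0//.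
by apply: prodr_gt0.
Qed.

Let sum_q (b : G) : \sum_c q c = 1.
Proof.
rewrite -mulr_sumr exchange_big/=.
under eq_bigr => b' _.
  rewrite -(bigA_distr_bigA (fun i a => noisy a (guess i b')))/=.
  rewrite big1 => [|i _]; last exact: sum_noisy.
  over.
by rewrite sumr_const mulVf// gt_eqF// card_gt0.
Qed.

Let q_cost (c : {ffun _ -> I}) b :
  - ln (q c) <= ln #|G|%:R + \sum_i cost (c i != guess i b).
Proof.
have G0 := card_gt0 b.
have N0 : 0 < \prod_i noisy (c i) (guess i b) by apply: prodr_gt0.
apply: (@le_trans _ _
    (- ln (#|G|%:R^-1 * \prod_i noisy (c i) (guess i b)))).
  have L0 : 0 < #|G|%:R^-1 * \prod_i noisy (c i) (guess i b).
    by rewrite mulr_gt0 ?invr_gt0.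
  by rewrite lerN2 ler_ln ?posrE// ?(q_gt0 b)// q_ge.
rewrite lnM ?posrE ?invr_gt0// lnV ?posrE// opprD opprK lerD2l.
apply: (@le_trans _ _ (\sum_i - ln (noisy (c i) (guess i b)))); last first.
  by apply: ler_sum.
rewrite sumrN lerN2.
have : forall s : seq 'I_k, \sum_(i <- s) ln (noisy (c i) (guess i b)) <=
    ln (\prod_(i <- s) noisy (c i) (guess i b)).
  elim=> [|i s IH]; first by rewrite !big_nil ln1.
  by rewrite !big_cons lnM ?posrE ?lerD2l// prodr_gt0.
exact.
Qed.

Lemma entropy_coding :
  entropy mu (atoms (fun x => [ffun i => F i x])) <=
  ln #|G|%:R + k%:R * (- ln (1 - del) + eps * ln (n / del)).
Proof.
pose f x : {ffun 'I_k -> I} := [ffun i => F i x]; rewrite -/f.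
have mf : discrete_measurable f by exact: discrete_measurable_ffun.
have mfg := discrete_measurable_pair mf mg.
have b0 : G := g point.
rewrite entropy_atoms.
apply: le_trans (gibbs (fun=> prob_ge0 mu _) (q_gt0 b0) _) _.
  by rewrite (sum_prob mu mf) (sum_q b0).
pose fg x := (f x, g x).
rewrite -sumrN; under eq_bigr do rewrite -mulrN.
rewrite (@sum_prob_comp _ _ _ mu _ _ fg fst (fun c => - ln (q c)) mfg).
apply: (@le_trans _ _ (\sum_cb prob (fg @^-1` [set cb]) *
    (ln #|G|%:R + \sum_i cost (cb.1 i != guess i cb.2)))).
  by apply: ler_sum => cb _; rewrite ler_wpM2l ?prob_ge0// q_cost.
under eq_bigr do rewrite mulrDr mulr_sumr.
rewrite big_split/= -mulr_suml (sum_prob mu mfg) mul1r lerD2l exchange_big/=.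
apply: (@le_trans _ _ (\sum_(i < k) (- ln (1 - del) + eps * ln (n / del)))).
  apply: ler_sum => i _.
  pose err (cb : {ffun 'I_k -> I} * G) := cb.1 i != guess i cb.2.
  rewrite -(@sum_prob_comp _ _ _ mu _ _ fg err cost mfg) big_bool/=.
  have merr := discrete_measurable_comp err mfg.
  have := sum_prob mu merr; rewrite big_bool/=.
  set e := prob _; set e' := prob _ => ee'.
  have e_le : e <= eps.
    apply: le_trans (guessP i); rewrite le_eqVlt; apply/orP; left; apply/eqP.
    by congr fine; congr (mu _); apply/seteqP; split=> x; rewrite /= /err/= ffunE.
  have n1 : 1 <= n by rewrite ler1n; apply/card_gt0P; exists (F i point).
  have l0 : 0 <= ln (n / del).
    by rewrite ln_ge0// ler_pdivlMr// mul1r (le_trans (ltW del1)).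
  rewrite /cost mul1r mul0r addr0 mulrDr addrAC -mulrDl ee' mul1r lerD2l.
  exact: ler_wpM2r.
by rewrite sumr_const card_ord mulr_natl.
Qed.

End coding.

(** With [a <= b], the factor [(a + b) / a] is at least 2. *)
Let split_gain (a b : R) : 0 <= a -> a <= b ->
  a * ln a + b * ln b + a * ln 2 <= (a + b) * ln (a + b).
Proof.
rewrite le_eqVlt => /predU1P[<- _|a0 ab].
  by rewrite !mul0r addr0 !add0r.
have b0 := lt_le_trans a0 ab.
rewrite addrAC -mulrDr -lnM ?posrE// mulrDl lerD//.
  rewrite ler_pM2l// ler_ln ?posrE ?addr_gt0 ?mulr_gt0//.
  by rewrite mulr_natr mulr2n lerD2l.
by rewrite ler_pM2l// ler_ln ?posrE ?addr_gt0// lerDr ltW.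
Qed.

Let sum_bool_pair (J : finType) (phi : bool * J -> R) :
  \sum_bj phi bj = \sum_j (phi (true, j) + phi (false, j)).
Proof.
rewrite -(eq_bigr _ (fun bj _ => congr1 phi (esym (surjective_pairing bj)))).
rewrite -(pair_bigA _ (fun b j => phi (b, j)))/= exchange_big/=.
by apply: eq_bigr => j _; rewrite big_bool.
Qed.

(** An atom of [f] cut into pieces of measures [a] and [b] contributes at least
[min a b * ln 2] to the increase of the entropy.  The sum of these minima is the
distance from [g] to the closest union of atoms of [f], which takes the atoms of
which [g] fills at least a half. *)
Lemma entropy_gain (J : finType) (f : T -> J) (g : T -> bool) (eta : R) :
  discrete_measurable f -> discrete_measurable g ->
  (forall C : {set J}, eta <= prob [set x | g x != (f x \in C)]) ->
  entropy mu (atoms f) + eta * ln 2 <= entropy mu (atoms (fun x => (g x, f x))).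
Proof.
move=> mf mg far; rewrite !entropy_atoms.
have mgf := discrete_measurable_pair mg mf.
pose p bj := prob ((fun x => (g x, f x)) @^-1` [set bj]).
have p0 bj : 0 <= p bj by exact: prob_ge0.
have pE j : prob (f @^-1` [set j]) = p (true, j) + p (false, j).
  rewrite (_ : f @^-1` [set j] = [set x | (g x, f x).2 == j]); last first.
    by apply/seteqP; split=> x /= /eqP.
  rewrite (prob_sum mu (fun bj => bj.2 == j) mgf) big_mkcond sum_bool_pair/=.
  by rewrite (bigD1 j)//= eqxx big1 ?addr0// => i /negbTE ->; rewrite addr0.
pose C := [set j | p (false, j) <= p (true, j)]%SET.
pose m j := if j \in C then p (false, j) else p (true, j).
have farC : eta <= \sum_j m j.
  apply: le_trans (far C) _.
  rewrite (prob_sum mu (fun bj => bj.1 != (bj.2 \in C)) mgf).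
  rewrite big_mkcond sum_bool_pair/= le_eqVlt; apply/orP; left; apply/eqP.
  by apply: eq_bigr => j _; rewrite /m; case: (j \in C); rewrite ?addr0 ?add0r.
apply: (@le_trans _ _ (- \sum_j prob (f @^-1` [set j]) *
    ln (prob (f @^-1` [set j])) + (\sum_j m j) * ln 2)).
  by rewrite lerD2l ler_wpM2r// ln_ge0// ler1n.
rewrite -/p sum_bool_pair mulr_suml -!sumrN -big_split/=.
apply: ler_sum => j _; rewrite pE addrC lerBlDr addrC lerBrDr.
rewrite -!/(p _) /m inE [leLHS]addrC; case: (leP (p (false, j))) => [le|/ltW le].
  rewrite [p (true, j) + _]addrC [X in X + _ <= _]addrC; exact: split_gain.
exact: split_gain.
Qed.

End entropy_bounds.

(** * The distance in measure, and totally bounded sets *)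

Section disagreement.
Context d (T : measurableType d) (R : realType) (mu : probability T R).

(** The distance in measure of two labellings; for indicators it is the measure
of the symmetric difference. *)
Definition disag (J : eqType) (f g : T -> J) : R :=
  prob mu [set x | f x != g x].

Lemma disag_measurable (J : finType) (f g : T -> J) :
  discrete_measurable f -> discrete_measurable g ->
  measurable [set x | f x != g x].
Proof.
move=> mf mg.
exact: (discrete_measurable_pair mf mg [set jk : J * J | jk.1 != jk.2]).
Qed.

Lemma disag_sym (J : eqType) (f g : T -> J) : disag f g = disag g f.
Proof.
by congr fine; congr (mu _); apply/seteqP; split=> x /=; rewrite eq_sym.
Qed.

Lemma disag_triangle (J : finType) (g f h : T -> J) :
  discrete_measurable f -> discrete_measurable g -> discrete_measurable h ->
  disag f h <= disag f g + disag g h.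
Proof.
move=> mf mg mh; apply: le_trans (prob_setU_le _ _ _); last 2 first.
- exact: disag_measurable.
- exact: disag_measurable.
apply: prob_le; [exact: disag_measurable|..].
  by apply: measurableU; exact: disag_measurable.
move=> x /= fh; have [fg|/eqP] := eqVneq (f x) (g x); last by left; apply/eqP.
by right; rewrite -fg.
Qed.

Lemma discrete_measurable_indic (A : set T) :
  measurable A -> discrete_measurable (fun x => x \in A).
Proof.
move=> mA; apply: discrete_measurable_fin => -[].
  rewrite (_ : _ @^-1` _ = A)//.
  by apply/seteqP; split=> x /=; [move=> /set_mem|move=> /mem_set].
rewrite (_ : _ @^-1` _ = ~` A); first exact: measurableC.
by apply/seteqP; split=> x /= => [/negbT/negP|xA]; rewrite ?in_setE//;
  apply/negbTE/negP; rewrite in_setE.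
Qed.

(** The limit is the set of points that lie in all but finitely many [B n].  It
differs from [B n] only where some later [B m] and [B m.+1] differ, and these sets
have summable measures. *)
Lemma disag_complete (B : nat -> T -> bool) :
  (forall n, discrete_measurable (B n)) ->
  (forall n, disag (B n) (B n.+1) <= 2 ^- n) ->
  exists2 C : T -> bool, discrete_measurable C &
    forall n, disag (B n) C <= 2 * 2 ^- n.
Proof.
move=> mB dB; pose A := \bigcup_N \bigcap_(m in [set m | (N <= m)%N])
  [set x | B m x].
have mA : measurable A.
  apply: bigcup_measurable => N _; apply: bigcap_measurable => [|m _].
    by exists N => /=.
  exact: mB m [set b | b].
have mC := discrete_measurable_indic mA.
exists (fun x => x \in A) => // n.
pose D k := [set x | B (n + k)%N x != B (n + k.+1)%N x].
have mD k : measurable (D k) by exact: disag_measurable.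
rewrite -lee_fin EFin_prob; last exact: disag_measurable.
apply: (@le_trans _ _ (\sum_(k <oo) mu (D k))%E).
  apply: measure_sigma_subadditive => //; first exact: disag_measurable.
  move=> x /= neq; apply: contrapT => xD.
  have eqB k : B (n + k)%N x = B n x.
    elim: k => [|k <-]; first by rewrite addn0.
    by apply/esym/eqP/negPn/negP => h; apply: xD; exists k.
  move/negP: neq; apply; apply/eqP; apply/idP/idP => [Bx|/set_mem[N _ AN]].
    apply/mem_set; exists n => // m /= nm.
    by rewrite -(subnKC nm) eqB.
  by rewrite -(eqB N); apply: AN => /=; rewrite leq_addl.
apply: (@le_trans _ _ (\sum_(k <oo) ((2 * 2 ^- n) / (2 ^ k.+1)%:R)%:E)%E).
  apply: lee_nneseries => [k _ _|k _]; first exact: measure_ge0.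
  rewrite -EFin_prob// lee_fin /D addnS; apply: le_trans (dB _) _.
  rewrite natrX exprS invfM mulrACA divff ?pnatr_eq0// mul1r exprD invfM//.
by apply: (epsilon_trick0 xpredT); rewrite mulr_ge0// invr_ge0 exprn_ge0.
Qed.

End disagreement.

Section totally_bounded.
Context (R : realType) (W : choiceType).

(** The finite sequences ordered by inclusion form a filter, so that near-covering
compactness selects a single finite sequence of centres. *)
Lemma compact_closure_net (M : pseudoMetricType R) (phi : W -> M) (D : set W) :
  compact (closure (phi @` D)) -> forall e, 0 < e ->
  exists s : seq W, forall w, D w -> exists2 u, u \in s & ball (phi u) e (phi w).
Proof.
move=> /compact_near_coveringP cK e e0.
pose F : set_system (seq W) :=
  
    [set A : set (seq W) | exists s0 : seq W, forall s : seq W,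
      {subset s0 <= s} -> A s].
have FF : Filter F.
  split; first by exists [::].
    move=> A B [s As] [t Bt]; exists (s ++ t) => r str; split.
      by apply: As => x xs; apply: str; rewrite mem_cat xs.
    by apply: Bt => x xt; apply: str; rewrite mem_cat xt orbT.
  by move=> A B AB [s As]; exists s => t /As /AB.
have := cK _ F (fun s x => exists2 u, u \in s & ball (phi u) e x) FF.
case=> [x Kx|s sP]; last first.
  exists s => w Dw; apply: (sP s) => //; apply: subset_closure.
  by exists w.
have e20 : 0 < e / 2 by rewrite divr_gt0.
have [_ [[u Du <-]]] := Kx _ (nbhsx_ballx x _ e20).
move=> xu; exists (ball x (e / 2), [set s : seq W | u \in s]) => /=.
  split; first exact: nbhsx_ballx.
  by exists [:: u] => s; apply; rewrite mem_head.
move=> [y s] /= [xy us]; exists u => //.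
by rewrite (splitr e); apply: ball_triangle xy; exact: ball_sym.
Qed.

(** An ultrafilter on a totally bounded set contains a ball of each radius.  The
centres of balls of radius [2 ^- n / 2] form a fast Cauchy sequence, whose limit is
the limit of the ultrafilter. *)
Lemma net_compact_closure (M : pseudoMetricType R) (phi : W -> M) (D : set W) :
  (forall e, 0 < e -> exists2 s : seq W, {subset s <= D} &
    forall w, D w -> exists2 u, u \in s & ball (phi u) e (phi w)) ->
  (forall w : nat -> W, (forall n, D (w n)) ->
    (forall n, ball (phi (w n)) (2 ^- n) (phi (w n.+1))) ->
    exists m : M, phi (w n) @[n --> \oo] --> m) ->
  compact (closure (phi @` D)).
Proof.
move=> net cpl; rewrite compact_ultra => F FU FK.
have FP : ProperFilter F by exact: ultra_proper.
have small e : 0 < e -> exists2 u, D u & F (ball (phi u) e).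
  move=> e0; have e20 : 0 < e / 2 by rewrite divr_gt0.
  have [s sD sP] := net _ e20.
  have : F (\bigcup_(u in [set` s]) ball (phi u) e).
    apply: filterS FK => x Kx.
    have [_ [[w Dw <-] xw]] := Kx _ (nbhsx_ballx x _ e20).
    have [u us uw] := sP w Dw; exists u => //=.
    by rewrite (splitr e); apply: ball_triangle uw _; exact: ball_sym.
  elim: s sD {sP} => [_|u s IH sD].
    by rewrite set_nil bigcup_set0 => /filter_not_empty.
  move=> FU'; have [|nu] := in_ultra_setVsetC (ball (phi u) e) FU.
    by exists u => //; apply/set_mem/sD; rewrite mem_head.
  apply: IH => [v vs|]; first by apply: sD; rewrite inE vs orbT.
  apply: filterS2 FU' nu => x [v /=]; rewrite inE => /predU1P[->//|vs] vx _.
  by exists v.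
have r0 n : 0 < 2 ^- n / 2 :> R by rewrite divr_gt0// invr_gt0 exprn_gt0.
pose w n := sval (cid2 (small _ (r0 n))).
have wD n : D (w n) by rewrite /w; case: cid2.
have wF n : F (ball (phi (w n)) (2 ^- n / 2)) by rewrite /w; case: cid2.
have [n|m wm] := cpl w wD.
  have [x [x1 x2]] := filter_ex (filterI (wF n) (wF n.+1)).
  rewrite (splitr (2 ^- n)); apply: ball_triangle x1 _.
  apply: (@le_ball _ _ _ (2 ^- n.+1 / 2)); last exact: ball_sym.
  rewrite ler_pM2r// lef_pV2 ?posrE ?exprn_gt0//.
  by rewrite exprS ler_peMl ?exprn_ge0// ler1n.
exists m; split.
  move=> B mB; have [n _ /(_ n (leqnn n)) Bn] := wm _ mB.
  by exists (phi (w n)); split=> //; exists (w n).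
apply/cvg_ballP => e e0; have e20 : 0 < e / 2 by rewrite divr_gt0.
have /cvg_ballP/(_ _ e20)[N _ Nm] := wm.
have [K _ Ke] : \forall n \near \oo, 2 ^- n < e / 2 :> R.
  near=> n; rewrite -exprVn; near: n.
  apply: cvgr_lt e20; apply: cvg_expr.
  by rewrite gtr0_norm ?invr_gt0// invf_lt1// ltr1n.
pose n := maxn N K.
have nK : 2 ^- n < e / 2 :> R by apply: Ke => /=; rewrite leq_maxr.
have mn : ball m (e / 2) (phi (w n)) by apply: Nm => /=; rewrite leq_maxl.
apply: filterS (wF n) => x; rewrite (splitr e) => nx; apply: ball_triangle mn _.
apply: le_ball nx; apply: le_trans (ltW nK).
by rewrite ler_pdivrMr// ler_peMr ?invr_ge0 ?exprn_ge0// ler1n.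
Unshelve. all: end_near.
Qed.

End totally_bounded.

(** * Indicators in the Hilbert space *)

Section indicators_in_L2.
Context d (T : measurableType d) (R : realType) (mu : probability T R).
Variables (A B : set T) (mA : measurable A) (mB : measurable B).
Variables (LA : (\1_A : T -> R) \in Lfun mu 2%:R%:E).
Variables (LB : (\1_B : T -> R) \in Lfun mu 2%:R%:E).

Lemma mdist_indic :
  mdist (L2_class LA) (L2_class LB) =
  Num.sqrt (disag mu (fun x => x \in A) (fun x => x \in B)).
Proof.
set D := [set x | (x \in A) != (x \in B)].
have mD : measurable D.
  by apply: disag_measurable; exact: discrete_measurable_indic.
have mclass (f : LspaceType2 mu) : measurable_fun setT (f : T -> R).
  exact: set_mem (sub_Lfun_mfun (Lspace_Lfun f)).
rewrite -[LHS]/(Lp_dist _ _) /Lp_dist unlock.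
set N2 := (\int[mu]_x _)%E.
suff -> : N2 = (disag mu (fun x => x \in A) (fun x => x \in B))%:E.
  by rewrite poweR_EFin/= powR12_sqrt// prob_ge0.
rewrite /disag EFin_prob// -/D -[in RHS](setIT D) -integral_indic//.
apply: ae_eq_integral => //.
- apply: (measurableT_comp (measurable_poweR _)) => //.
  apply: measurableT_comp => //; apply/measurable_EFinP.
  exact: measurable_funB.
- by apply/measurable_EFinP.
apply: filterS2 (L2_classE LA) (L2_classE LB) => x /(_ I) eA /(_ I) eB _.
have -> : (EFin \o ((L2_class LA : T -> R) \- (L2_class LB : T -> R))) x =
  (\1_A x - \1_B x)%:E by rewrite -eA -eB.
rewrite abse_EFin poweR_EFin !indicE.
rewrite [in RHS](_ : (x \in D) = (x \in A) (+) (x \in B)).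
  by case: (x \in A); case: (x \in B);
    rewrite /= ?subrr ?subr0 ?sub0r ?normrN ?normr1 ?normr0 ?powR1 ?powR0.
by apply/idP/idP => [/set_mem|xAB]; [|apply/mem_set; move: xAB]; rewrite /D/=;
  case: (x \in A); case: (x \in B).
Qed.
End indicators_in_L2.

Section system.
Context (R : realType) (q : nat) (X : pmetricType R) (S : Zq_MPS q X).
Notation mu := (mps_mu S).

Lemma measurable_act w (B : set (borel X)) :
  measurable B -> measurable ((S w : borel X -> borel X) @^-1` B).
Proof. by move=> mB; rewrite -[_ @^-1` _]setTI; exact: mps_measurable. Qed.

(** The class of the indicator of [B] is only known almost everywhere; composing
it with [S w] is harmless because [S w] pulls null sets back to null sets. *)
Lemma koopman_indic w (B : set (borel X)) (mB : measurable B) :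
  koopman w (L2_indic S mB) = L2_indic S (measurable_act w mB).
Proof.
apply: Lspace_eq.
apply: ae_eq_trans (L2_compE _ _ _) _.
apply: ae_eq_trans (ae_eq_sym (L2_classE _)).
have [N [mN N0 NP]] := L2_classE (Lfun_indic (mps_fin S) mB).
exists (S w @^-1` N); split; first exact: measurable_act.
  rewrite -N0; exact: (mps_inv S w mN).
move=> x /= nx; apply: NP => /= fx; apply: nx => _; exact: fx.
Qed.

End system.

(** * Pigeonhole arguments and strips *)

(** The pigeonhole principle behind all the finite nets: one representative for
each class [k] that occurs. *)
Lemma finite_reps (W K : eqType) (D : set W) (rel : W -> K -> Prop)
    (t : seq K) :
  (forall w, D w -> exists2 k, k \in t & rel w k) ->
  exists2 s : seq W, (forall u, u \in s -> D u) &
    forall w, D w -> exists2 u, u \in s & exists k, rel w k /\ rel u k.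
Proof.
elim: t D => [|k t IH] D Dt; first by exists [::] => // w /Dt[].
have [w [Dw [l lt wl]]|s sD sP] := IH [set w | D w /\ exists2 l, l \in t & rel w l].
  by exists l.
have [[w0 Dw0 w0k]|noD] := pselect (exists2 w, D w & rel w k).
  exists (w0 :: s) => [u|w Dw].
    by rewrite inE => /predU1P[->//|/sD[]].
  have [l] := Dt w Dw; rewrite inE => /predU1P[->|lt] wl.
    by exists w0; [exact: mem_head|exists k].
  have [|u us uw] := sP w; first by split=> //; exists l.
  by exists u => //; rewrite inE us orbT.
exists s => [u /sD[]//|w Dw]; apply: sP; split=> //.
have [l] := Dt w Dw; rewrite inE => /predU1P[->|lt] wl; last by exists l.
by case: noD; exists w.
Qed.

(** Dependent choice in which a term may depend on all previous ones. *)
Lemma greedy_sequence (W : Type) (P : seq W -> W -> Prop) :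
  (forall s, exists w, P s w) ->
  exists w : nat -> W, forall k, P (mkseq w k) (w k).
Proof.
move=> exP; pose next s := sval (cid (exP s)).
have nextP s : P s (next s) by rewrite /next; case: cid.
pose L k := iter k (fun s => rcons s (next s)) [::].
exists (next \o L) => k; suff -> : mkseq (next \o L) k = L k by exact: nextP.
by elim: k => [//|k IH]; rewrite mkseqS IH.
Qed.

Section strips.
Context (R : realType) (r : nat) (v : 'rV[R]_r.+1).

(** The offsets of the points of the wide strip from the line through [v] lie in
a box, which is cut into cells of half the size of the narrow strip.  Two points
in the same cell differ by a point of the narrow strip, so that one
representative for each cell suffices. *)
Lemma Lambda_cover (b b' : 'rV[R]_r) : positive_vector b ->
  exists s : seq 'rV[int]_r.+1, forall w, Lambda v b' w ->
    exists2 u, u \in s & Lambda v b (w - u).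
Proof.
move=> b0.
pose off (w : 'rV[int]_r.+1) i : R :=
  (w 0 (lift ord0 i))%:~R - v 0 (lift ord0 i) * (w 0 ord0)%:~R + b' 0 i / 2.
pose cell w i := Num.truncn (off w i / (b 0 i / 2)).
have b20 i : 0 < b 0 i / 2 by rewrite divr_gt0// b0.
pose N := (\max_(i < r) Num.truncn (b' 0 i / (b 0 i / 2))%R)%N.
have off_ge0 w i : Lambda v b' w -> 0 <= off w i.
  by move=> /(_ i)/andP[+ _]; rewrite /off; lra.
have cell_le w i : Lambda v b' w -> (cell w i <= N)%N.
  move=> Lw; apply: leq_trans (leq_bigmax i); apply: le_truncn.
  rewrite ler_pM2r ?invr_gt0//.
  by have /andP[_] := Lw i; rewrite /off; lra.
have [|s sL sP] := @finite_reps _ _ (Lambda v b')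
    (fun w (k : {ffun 'I_r -> 'I_N.+1}) => forall i, k i = cell w i :> nat)
    (enum {ffun 'I_r -> 'I_N.+1}).
  move=> w Lw; exists [ffun i => inord (cell w i)]; first by rewrite mem_enum.
  by move=> i; rewrite ffunE inordK// ltnS cell_le.
exists s => w Lw; have [u us [k [wk uk]]] := sP w Lw; exists u => // i.
have Lu := sL u us.
have := wk i; rewrite uk /cell => cuw.
have ge x : Lambda v b' x ->
    (Num.truncn (off x i / (b 0 i / 2)))%:R * (b 0 i / 2) <= off x i /\
    off x i < (Num.truncn (off x i / (b 0 i / 2)))%:R * (b 0 i / 2) + b 0 i / 2.
  move=> Lx; rewrite -[X in _ < _ + X]mul1r -mulrDl natr1.
  rewrite -ler_pdivlMr// -ltr_pdivrMr//.
  by apply/andP; apply: truncn_itv; rewrite divr_ge0 ?off_ge0// ltW.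
have [w1 w2] := ge w Lw; have [u1 u2] := ge u Lu.
move: u1 u2 w1 w2; rewrite cuw /off !mxE !rmorphB/=.
set M := _%:R * _ => u1 u2 w1 w2.
by apply/andP; split; lra.
Qed.

End strips.

(** * Orbits in the measure algebra *)

Section orbits.
Context (R : realType) (q : nat) (X : pmetricType R) (S : Zq_MPS q X).
Notation mu := (mps_mu S).
Notation Z := 'rV[int]_q.

(** Total boundedness of the translates [f \o S w], [w] in [D].  The centres
[u] need not belong to [D], which makes nets easy to transport between strips. *)
Definition orbit_net (D : set Z) (J : eqType) (f : borel X -> J) :=
  forall e : R, 0 < e -> exists s : seq Z, forall w, D w ->
    exists2 u, u \in s & disag mu (f \o S w) (f \o S u) < e.

Lemma discrete_measurable_act (J : Type) (f : borel X -> J) w :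
  discrete_measurable f -> discrete_measurable (f \o S w : borel X -> J).
Proof. by move=> mf P; exact: (@measurable_act _ _ _ S w _ (mf P)). Qed.

Lemma compact_orbit_net (D : set Z) (B : set (borel X)) (mB : measurable B) :
  compact (closure [set koopman w (L2_indic S mB) | w in D]) ->
  orbit_net D (fun x => x \in B).
Proof.
move=> cB e e0; have se0 : 0 < Num.sqrt e by rewrite sqrtr_gt0.
have [s sP] := compact_closure_net cB se0.
exists s => w /sP[u us]; rewrite ballEmdist/= !koopman_indic mdist_indic.
- by rewrite ltr_sqrt// disag_sym => wu; exists u.
- exact: measurable_act.
- exact: measurable_act.
Qed.

Lemma orbit_net_compact (D : set Z) (B : set (borel X)) (mB : measurable B) :
  orbit_net D (fun x => x \in B) ->
  compact (closure [set koopman w (L2_indic S mB) | w in D]).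
Proof.
move=> netB.
have mball u w e : 0 < e ->
    disag mu (fun x => S u x \in B) (fun x => S w x \in B) < e ^+ 2 <->
    ball (koopman u (L2_indic S mB)) e (koopman w (L2_indic S mB)).
  move=> e0; rewrite ballEmdist/= !koopman_indic mdist_indic; last 2 first.
  - exact: measurable_act.
  - exact: measurable_act.
  by rewrite -ltr_sqrt ?exprn_gt0// sqrtr_sqr gtr0_norm.
have mi w : discrete_measurable (fun x : borel X => S w x \in B).
  exact: (discrete_measurable_act w (discrete_measurable_indic mB)).
apply: net_compact_closure => [e e0|w wD near_w].
  have e24 : 0 < e ^+ 2 / 2 by rewrite divr_gt0// exprn_gt0.
  have [t tP] := netB _ e24.
  have [s sD sP] := finite_reps tP.
  exists s => [u /sD Du|w /sP]; first exact/mem_set.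
  move=> [u us [k [wk uk]]]; exists u => //; apply/mball => //.
  apply: le_lt_trans (disag_triangle _ (mi u) (mi k) (mi w)) _.
  by rewrite [ltRHS]splitr ltrD// disag_sym.
pose B_ n (x : borel X) := S (w n) x \in B.
have r0 n : 0 < 2 ^- n :> R by rewrite invr_gt0 exprn_gt0.
have [n|n|C mC BC] := @disag_complete _ _ _ mu B_.
- exact: mi.
- apply/ltW; have /mball := near_w n; move=> /(_ (r0 n)) h; apply: lt_le_trans h _.
  rewrite -[leRHS]mulr1 expr2 ler_pM2l// invf_le1 ?exprn_gt0//.
  by rewrite exprn_ege1// ler1n.
have mC1 : measurable ([set x | C x] : set (borel X)) by exact: mC.
exists (L2_indic S mC1).
apply/cvg_ballP => e e0.
have [K _ Ke] : \forall n \near \oo, 2 ^- n < e ^+ 2 / 2 :> R.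
  near=> n; rewrite -exprVn; near: n.
  have e2 : 0 < e ^+ 2 / 2 by rewrite divr_gt0// exprn_gt0.
  apply: cvgr_lt e2; apply: cvg_expr.
  by rewrite gtr0_norm ?invr_gt0// invf_lt1// ltr1n.
exists K => // n /Ke/= ne; rewrite ballEmdist/= koopman_indic mdist_indic//; last first.
  exact: measurable_act.
rewrite -(gtr0_norm e0) -sqrtr_sqr ltr_sqrt ?exprn_gt0// disag_sym.
rewrite ltr_pdivlMr// mulrC in ne; apply: le_lt_trans ne.
suff <- : C = (fun x => x \in [set x | C x]) by exact: BC.
by apply/funext => x; apply/idP/idP => [/mem_set|/set_mem].
Unshelve. all: end_near.
Qed.

(** For [w] in [u + D] the translate of [B] by [w] is the translate of
[S u @^-1` B] by [w - u] in [D], so the nets of these finitely many sets, shifted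
by [u], form a net for [B]. *)
Lemma orbit_net_Lambda (D D' : set Z) (B : set (borel X)) (s0 : seq Z) :
  measurable B -> (forall w, D' w -> exists2 u, u \in s0 & D (w - u)) ->
  (forall u, orbit_net D (fun x => x \in S u @^-1` B)) ->
  orbit_net D' (fun x => x \in B).
Proof.
move=> mB cover nets e e0; pose t u := sval (cid (nets u e e0)).
have tP u : forall w, D w -> exists2 u', u' \in t u &
    disag mu (fun x => S w x \in S u @^-1` B)
             (fun x => S u' x \in S u @^-1` B) < e.
  by rewrite /t; case: cid.
exists [seq u + u' | u <- s0, u' <- t u] => w /cover[u us Dwu].
have [u' u't uu'] := tP u _ Dwu; exists (u + u').
  by apply/allpairsPdep; exists u, u'.
have SD u1 u2 x : S (u1 + u2) x = S u1 (S u2 x) by rewrite -mps_actD.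
have -> : S w = S (u + (w - u)) by rewrite addrC subrK.
rewrite (_ : _ \o S (u + (w - u)) = fun x => S (w - u) x \in S u @^-1` B).
  rewrite (_ : _ \o S (u + u') = fun x => S u' x \in S u @^-1` B)//.
  by apply/funext => x /=; rewrite SD.
by apply/funext => x /=; rewrite SD.
Qed.

(** Two translates of [f] disagree only where some fibre of one differs from the
same fibre of the other.  Each [w] is classified by the centres that approximate
its translates of all the fibres. *)
Lemma orbit_net_fin (D : set Z) (I : finType) (f : borel X -> I) :
  discrete_measurable f ->
  (forall a, orbit_net D (fun x => f x == a)) -> orbit_net D f.
Proof.
move=> mf nets e e0.
pose e' := e / 2 / #|I|.+1%:R.
have e'0 : 0 < e' by rewrite !divr_gt0.
pose t a := sval (cid (nets a e' e'0)).
have tP a : forall w, D w -> exists2 u, u \in t a &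
    disag mu (fun x => f (S w x) == a) (fun x => f (S u x) == a) < e'.
  by rewrite /t; case: cid.
pose N := (\max_(a : I) size (t a))%N.
have mfa a w : discrete_measurable (fun x : borel X => f (S w x) == a).
  exact: (discrete_measurable_act w (discrete_measurable_comp (eq_op^~ a) mf)).
have [|s sD sP] := @finite_reps _ _ D
    (fun w (k : {ffun I -> 'I_N.+1}) => forall a,
      disag mu (fun x => f (S w x) == a)
               (fun x => f (S (nth 0 (t a) (k a)) x) == a) < e')
    (enum {ffun I -> 'I_N.+1}).
  move=> w Dw; pose u a := sval (cid2 (tP a w Dw)).
  have ut a : u a \in t a by rewrite /u; case: cid2.
  have wu a : disag mu (fun x => f (S w x) == a)
      (fun x => f (S (u a) x) == a) < e' by rewrite /u; case: cid2.
  exists [ffun a => inord (index (u a) (t a))]; first by rewrite mem_enum.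
  move=> a; rewrite ffunE inordK ?nth_index//.
  by rewrite ltnS ltnW// (leq_trans _ (leq_bigmax a))// index_mem.
exists s => w /sP[u us [k [wk uk]]]; exists u => //.
have wu a : disag mu (fun x => f (S w x) == a) (fun x => f (S u x) == a) <
    e' + e'.
  apply: le_lt_trans
    (disag_triangle _ (mfa a w) (mfa a (nth 0 (t a) (k a))) (mfa a u)) _.
  by rewrite ltrD// disag_sym.
have mfw u := discrete_measurable_act u mf.
apply: (@le_lt_trans _ _ (\sum_a
    disag mu (fun x => f (S w x) == a) (fun x => f (S u x) == a))).
  have mD a := disag_measurable (mfa a w) (mfa a u).
  apply: le_trans (prob_bigsetU_le _ _ mD).
  apply: prob_le; first exact: disag_measurable.
    exact: bigsetU_measurable.
  move=> x /= wux; rewrite -bigcup_seq; exists (f (S w x)).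
    by rewrite /= mem_index_enum.
  by rewrite /= eqxx; move: wux; rewrite eq_sym => /negbTE ->.
apply: (@le_lt_trans _ _ (\sum_(a : I) (e' + e'))).
  by apply: ler_sum => a _; exact: ltW.
rewrite sumr_const -mulr_natr -mulr2n /e' -mulrnAl -mulr_natr divfK ?pnatr_eq0//.
by rewrite mulrAC ltr_pdivrMr// ltr_pM2l// ltr_nat.
Qed.

End orbits.

(** * Partitions and sequence entropy *)

Section partitions.
Context d (T : measurableType d).

Lemma join_atoms (J K : Type) (h : T -> T) (f : T -> J) (g : T -> K) :
  join_partition (preimage_partition h (atoms f)) (atoms g) =
  atoms (fun x => (f (h x), g x)).
Proof.
have pairE x : (fun y => (f (h y), g y)) @^-1` [set (f (h x), g x)] =
    (h @^-1` (f @^-1` [set f (h x)])) `&` (g @^-1` [set g x]).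
  by apply/seteqP; split=> y /= [-> ->].
apply/seteqP; split.
  move=> A [[_ [_ [y _ <-] <-] [_ [z _ <-] <-]] /eqP/set0P[x [/= fx gx]]].
  by exists x => //; rewrite pairE fx gx.
move=> _ [x _ <-]; rewrite pairE; split.
  exists (h @^-1` (f @^-1` [set f (h x)])).
    by exists (f @^-1` [set f (h x)]) => //; exists (h x).
  by exists (g @^-1` [set g x]) => //; exists x.
by apply/eqP/set0P; exists x.
Qed.

Lemma atoms_partition (J : finType) (f : T -> J) :
  discrete_measurable f -> finite_measurable_partition (atoms f).
Proof.
move=> mf; split.
- rewrite (_ : atoms f = (fun j => f @^-1` [set j]) @` range f).
    by apply: finite_image; exact: finite_finset.
  by rewrite image_comp.
- by move=> _ [x _ <-]; exact: mf.
- split.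
  + apply/seteqP; split=> // x _; exists (f @^-1` [set f x]) => //.
    by exists x.
  + by move=> _ _ [x _ <-] [y _ <-] [z [/= <- <-]].
  + by move=> _ [x _ <-]; exists x.
Qed.

(** The label of a point is the element of the partition that contains it. *)
Lemma partition_atoms (alpha : set (set T)) :
  finite_measurable_partition alpha ->
  exists (I : finType) (f : T -> I), discrete_measurable f /\ alpha = atoms f.
Proof.
move=> [/finite_fsetP[s ->] meas [cov triv ne]].
have ex x : exists A : s, (val A) x.
  have : cover [set` s] id x by rewrite cov.
  by move=> [A sA Ax]; exists [` sA]%fset.
pose f x : s := sval (cid (ex x)).
have fx x : (val (f x)) x by rewrite /f; case: cid.
have fE (A : s) : f @^-1` [set A] = val A.
  apply/seteqP; split=> [x <-|x Ax]; first exact: fx.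
  apply: val_inj; apply: triv; [exact: valP|exact: valP|].
  by exists x.
exists s, f; split.
  by apply: discrete_measurable_fin => A; rewrite fE; apply: meas; exact: valP.
apply/seteqP; split=> [A sA|_ [x _ <-]]; last by rewrite fE; exact: valP.
have [x Ax] := ne A sA; exists x => //.
suff -> : f x = [` sA]%fset by rewrite fE.
by have : (f @^-1` [set [` sA]%fset]) x by rewrite fE.
Qed.

End partitions.

Section sequence_entropy.
Context (R : realType) (q : nat) (X : pmetricType R) (S : Zq_MPS q X).
Notation mu := (mps_mu S).
Notation Z := 'rV[int]_q.

Lemma partition_along_atoms (w : nat -> Z) (J : finType) (f : borel X -> J) k :
  partition_along S w (atoms f) k =
  atoms (fun x : borel X => [ffun i : 'I_k => f (S (w i) x)]).
Proof.
elim: k w => [|k IH] w; rewrite /partition_along.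
  rewrite big_ord0; apply/seteqP; split=> [_ ->|_ [x _ <-]].
    exists point => //; apply/seteqP; split=> // x _ /=.
    by apply/ffunP => -[].
  by apply/seteqP; split=> // y _ /=; apply/ffunP => -[].
rewrite big_ord_recl/=.
have := IH (w \o succn); rewrite /partition_along => ->.
rewrite join_atoms; apply: eq_atoms => x y; split=> [[e0 /ffunP e]|/ffunP e].
  apply/ffunP => i; rewrite !ffunE; case: (unliftP ord0 i) => [j ->|-> //].
  by have := e j; rewrite !ffunE.
congr pair; first by have := e ord0; rewrite !ffunE.
by apply/ffunP => i; have := e (lift ord0 i); rewrite !ffunE.
Qed.

Lemma seq_entropy_part_le (w : nat -> Z) alpha (c : R) :
  (\forall k \near \oo,
    k%:R^-1 * entropy mu (partition_along S w alpha k) <= c) ->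
  (seq_entropy_part S w alpha <= c%:E)%E.
Proof.
move=> [N _ Nc]; rewrite /seq_entropy_part /limn_esup limf_esupE.
pose u k := (k%:R^-1 * entropy mu (partition_along S w alpha k))%:E.
rewrite -/u.
apply: (@le_trans _ _ (ereal_sup (u @` [set k | (N <= k)%N]))).
  apply: ereal_inf_lbound; exists [set k | (N <= k)%N] => //.
  by exists N.
by apply: ge_ereal_sup => _ [k Nk <-]; rewrite lee_fin; exact: Nc.
Qed.

Lemma seq_entropy_part_ge (w : nat -> Z) alpha (c : R) :
  (\forall k \near \oo,
    c <= k%:R^-1 * entropy mu (partition_along S w alpha k)) ->
  (c%:E <= seq_entropy_part S w alpha)%E.
Proof.
move=> cu; rewrite /seq_entropy_part /limn_esup limf_esupE.
apply: le_ereal_inf_tmp => _ [A FA <-].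
have [k [Ak ck]] := filter_ex (filterI FA cu).
apply: (@le_trans _ _ (k%:R^-1 * entropy mu (partition_along S w alpha k))%:E).
  by rewrite lee_fin.
by apply: ereal_sup_ubound; exists k.
Qed.

(** The side information for [entropy_coding] consists of the labels along the
centres of a net.  With [del := 1 - expR (- eta)] the cost [- ln (1 - del)] of a
correct guess is [eta], and then [eps] is chosen such that the corrections cost at
most [eta] for each letter. *)
Lemma orbit_net_entropy (D : set Z) (I : finType) (f : borel X -> I)
    (w : nat -> Z) (eta : R) :
  discrete_measurable f -> orbit_net S D f -> range w `<=` D -> 0 < eta ->
  exists L : R, forall k, entropy mu (partition_along S w (atoms f) k) <=
    L + k%:R * (eta + eta).
Proof.
move=> mf net wD eta0.
pose del := 1 - expR (- eta).
have del1 : del < 1 by rewrite /del ltrBlDr ltrDl expR_gt0.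
have del0 : 0 < del by rewrite subr_gt0 -[ltRHS]expR0 ltr_expR oppr_lt0.
have n1 : 1 <= #|I|%:R :> R by rewrite ler1n; apply/card_gt0P; exists (f point).
pose l := ln (#|I|%:R / del : R).
have l0 : 0 <= l by rewrite ln_ge0// ler_pdivlMr// mul1r (le_trans (ltW del1)).
pose eps := eta / (l + 1).
have eps0 : 0 < eps by rewrite divr_gt0// ltr_wpDl.
have [s sP] := net eps eps0.
pose G := {ffun 'I_(size s).+1 -> I}.
pose g (x : borel X) : G := [ffun j : 'I_(size s).+1 => f (S (nth 0 s j) x)].
have mfS u : discrete_measurable (fun x : borel X => f (S u x)).
  exact: (discrete_measurable_act S u mf).
have mg : discrete_measurable g.
  by apply: discrete_measurable_ffun => j; exact: mfS.
have near i : D (w i) by apply: wD; exists i.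
pose u i := sval (cid2 (sP (w i) (near i))).
exists (ln #|G|%:R) => k; rewrite partition_along_atoms.
pose guess (i : 'I_k) (b : G) := b (inord (index (u i) s)).
apply: le_trans (@entropy_coding _ _ _ mu I G k (fun i x => f (S (w i) x)) g
  guess del eps _ mg del0 del1 _) _.
- by move=> i; exact: mfS.
- move=> i; have us : u i \in s by rewrite /u; case: cid2.
  have : disag mu (f \o S (w i)) (f \o S (u i)) < eps by rewrite /u; case: cid2.
  move=> /ltW; apply: le_trans; rewrite le_eqVlt; apply/orP; left; apply/eqP.
  congr fine; congr (mu _); apply/seteqP; split=> x /=;
    by rewrite /guess ffunE inordK ?nth_index// ltnS ltnW// index_mem.
rewrite lerD2l ler_wpM2l// /del opprB addrCA subrr addr0 expRK opprK lerD2l.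
by rewrite -/l /eps mulrAC ler_pdivrMr ?ltr_wpDl// ler_pM2l// lerDl.
Qed.

Lemma orbit_net_null (D : set Z) (w : nat -> Z) :
  (forall B : set (borel X), measurable B ->
    orbit_net S D (fun x => x \in B)) ->
  range w `<=` D -> seq_entropy S w = 0%E.
Proof.
move=> nets wD; apply/eqP; rewrite eq_le; apply/andP; split.
  apply: ge_ereal_sup => _ [alpha /partition_atoms[I [f [mf ->]]] <-].
  have netf : orbit_net S D f.
    apply: orbit_net_fin => // a.
    have := nets _ (mf [set a]); congr orbit_net; apply/funext => x.
    by apply/idP/eqP => [/set_mem|/mem_set].
  apply/lee_addgt0Pr => e e0; rewrite add0e.
  have eta0 : 0 < e / 3 by rewrite divr_gt0.
  have [L LP] := orbit_net_entropy mf netf wD eta0.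
  apply: seq_entropy_part_le; near=> k.
  have k0 : 0 < k%:R :> R by rewrite ltr0n; near: k; exact: nbhs_infty_gt.
  rewrite ler_pdivrMl//; apply: le_trans (LP k) _.
  have : L / (e / 3) <= k%:R by near: k; exact: nbhs_infty_ger.
  by rewrite ler_pdivrMr//; lra.
have mc : discrete_measurable (fun _ : borel X => tt).
  move=> P; have [Pt|nPt] := pselect (P tt).
    by rewrite (_ : _ @^-1` _ = setT)//; apply/seteqP; split.
  by rewrite (_ : _ @^-1` _ = set0)//; apply/seteqP; split.
apply: (@le_trans _ _ (seq_entropy_part S w (atoms (fun _ : borel X => tt)))).
  apply: seq_entropy_part_ge; near=> k.
  rewrite partition_along_atoms mulr_ge0 ?invr_ge0// entropy_atoms_ge0//.
  apply: discrete_measurable_ffun => i.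
  exact: (discrete_measurable_act S (w i) mc).
apply: ereal_sup_ubound; exists (atoms (fun _ : borel X => tt)) => //.
exact: atoms_partition.
Unshelve. all: end_near.
Qed.

(** A set in the algebra generated by the translates along [s] is given by a
boolean function [h] of the labels.  There are finitely many of them; if each
translate were within [e / 2] of one of them, representatives would form an
[e]-net. *)
Lemma orbit_gap (D : set Z) (f : borel X -> bool) (e : R) :
  discrete_measurable f ->
  (forall s : seq Z, exists2 w, D w & forall u, u \in s ->
    e <= disag mu (f \o S w) (f \o S u)) ->
  forall s : seq Z, exists w, D w /\ forall h : seq bool -> bool,
    e / 2 <= disag mu (f \o S w) (fun x => h [seq f (S u x) | u <- s]).
Proof.
move=> mf gap s; apply: contrapT => no.
have mfS u : discrete_measurable (f \o S u : borel X -> bool).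
  exact: (discrete_measurable_act S u mf).
pose g (x : borel X) := map_tuple (fun u => f (S u x)) (in_tuple s).
have mg : discrete_measurable g.
  have := discrete_measurable_ffun
    (fun i : 'I_(size s) => mfS (tnth (in_tuple s) i)).
  pose c2t (c : {ffun 'I_(size s) -> bool}) := [tuple c i | i < size s].
  move=> /(discrete_measurable_comp c2t); congr discrete_measurable.
  apply/funext => x; apply: eq_from_tnth => i.
  by rewrite /= /c2t tnth_mktuple ffunE tnth_map.
pose guess (C : {set (size s).-tuple bool}) (x : borel X) := g x \in C.
have mguess C : discrete_measurable (guess C).
  exact: (discrete_measurable_comp (fun t => t \in C) mg).
have [|t tD tP] := @finite_reps _ _ D
    (fun w C => disag mu (f \o S w) (guess C) < e / 2)
    (enum {set (size s).-tuple bool}).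
  move=> w Dw; apply: contrapT => noC; apply: no; exists w; split=> // h.
  rewrite leNgt; apply/negP => hw; apply: noC.
  exists [set t : (size s).-tuple bool | h t]%SET; first by rewrite mem_enum.
  suff -> : guess [set t : (size s).-tuple bool | h t]%SET =
    (fun x => h [seq f (S u x) | u <- s]) by [].
  by apply/funext => x; rewrite /guess inE.
have [w Dw far] := gap t; have [u ut [C [wC uC]]] := tP w Dw.
have := far u ut; apply/negP; rewrite -ltNge.
apply: le_lt_trans (disag_triangle _ (mfS w) (mguess C) (mfS u)) _.
by rewrite (splitr e) ltrD// disag_sym.
Qed.

(** Injectivity needs no separate choice: the previous translates belong to the
algebra that they generate, from which the next translate keeps its distance. *)
Lemma entropy_of_gap (D : set Z) (f : borel X -> bool) (e : R) : 0 < e ->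
  discrete_measurable f ->
  (forall s : seq Z, exists2 w, D w & forall u, u \in s ->
    e <= disag mu (f \o S w) (f \o S u)) ->
  exists w : nat -> Z, [/\ injective w, range w `<=` D &
    (0 < seq_entropy_part S w (atoms f))%E].
Proof.
move=> e0 mf /(orbit_gap mf)/greedy_sequence[w wP].
have e20 : 0 < e / 2 by rewrite divr_gt0.
have wNw i k : (i < k)%N -> w k <> w i.
  move=> ik wki; have [_ /(_ (fun l => nth false l i))] := wP k.
  rewrite (_ : (fun x => _) = f \o S (w k)); last first.
    apply/funext => x; rewrite (nth_map 0) ?size_mkseq// nth_mkseq//.
    by rewrite wki.
  apply/negP; rewrite -ltNge /disag (_ : [set x | _] = set0) ?prob_set0//.
  by apply/seteqP; split=> x //=; rewrite eqxx.
exists w; split.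
- by move=> i k wik; have [/wNw|/wNw|] := ltngtP i k; rewrite ?wik.
- by move=> _ [k _ <-]; have [] := wP k.
have mfS k : discrete_measurable (fun x : borel X => f (S (w k) x)).
  exact: (discrete_measurable_act S (w k) mf).
pose F k (x : borel X) := [ffun i : 'I_k => f (S (w i) x)].
have mF k : discrete_measurable (F k) by exact: discrete_measurable_ffun.
pose c := e / 2 * ln 2.
have c0 : 0 < c by rewrite mulr_gt0// ln_gt0// ltr1n.
have HF k : k%:R * c <= entropy mu (atoms (F k)).
  elim: k => [|k IH]; first by rewrite mul0r (entropy_atoms_ge0 mu (mF 0)).
  rewrite -natr1 mulrDl mul1r; apply: le_trans (lerD IH (lexx _)) _.
  apply: le_trans (entropy_gain (mF k) (mfS k) _) _.
    move=> C; have [_ /(_ (fun l => [ffun i : 'I_k => nth false l i] \in C))] := wP k.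
    move=> /le_trans; apply; rewrite le_eqVlt; apply/orP; left; apply/eqP.
    rewrite /disag; congr prob; apply/seteqP.
    have FE x : [ffun i : 'I_k => nth false [seq f (S u x) | u <- mkseq w k] i] = F k x.
      apply/ffunP => i; rewrite !ffunE (nth_map 0) ?size_mkseq// nth_mkseq//.
    by split=> x /=; rewrite FE.
  rewrite le_eqVlt; apply/orP; left; apply/eqP; congr entropy.
  apply: eq_atoms => x y; split=> [[ek /ffunP E]|/ffunP E].
    apply/ffunP => i; rewrite !ffunE; case: (unliftP ord_max i) => [j ->|-> //].
    by have := E j; rewrite !ffunE lift_max.
  congr pair; first by have := E ord_max; rewrite !ffunE.
  by apply/ffunP => i; have := E (lift ord_max i); rewrite !ffunE lift_max.
apply: (@lt_le_trans _ _ c%:E); first by rewrite lte_fin.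
apply: seq_entropy_part_ge; near=> k.
have k0 : 0 < k%:R :> R by rewrite ltr0n; near: k; exact: nbhs_infty_gt.
by rewrite partition_along_atoms ler_pdivlMl.
Unshelve. all: end_near.
Qed.

End sequence_entropy.

Theorem theoremB4 (R : realType) (r : nat) (r_gt0 : (0 < r)%N)
  (X : pmetricType R) (S : Zq_MPS r.+1 X)
  (v : 'rV[R]_r.+1) (v1 : v 0 ord0 = 1)
  (b : 'rV[R]_r) (b_gt0 : positive_vector b) :
  discrete_spectrum S v b <-> null_system S v.
Proof.
split=> [ds b' _ w _ wL|null].
  apply: (orbit_net_null _ wL) => B mB.
  have [s sP] := Lambda_cover v b' b_gt0.
  apply: (orbit_net_Lambda mB sP) => u.
  have mBu := measurable_act S u mB.
  have [mBu' cBu] : kronecker_algebra S v b (S u @^-1` B) by rewrite ds.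
  exact: compact_orbit_net cBu.
apply/seteqP; split=> [B []//|B mB]; exists mB.
apply: orbit_net_compact => e e0; apply: contrapT => no.
have mf := discrete_measurable_indic mB.
have [s|w [winj wL ent]] := @entropy_of_gap _ _ _ S (Lambda v b) _ e e0 mf.
  apply: contrapT => now; apply: no; exists s => w Lw.
  apply: contrapT => nou; apply: now; exists w => // u us.
  by rewrite leNgt; apply/negP => wu; apply: nou; exists u.
have := null b b_gt0 w winj wL; apply/eqP; rewrite gt_eqF//.
apply: (lt_le_trans ent); apply: ereal_sup_ubound.
by exists (atoms (fun x : borel X => x \in B)) => //; exact: atoms_partition.
Qed.
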